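(* Let $K\ge 2$, $k\ge 2$ and $n\ge 1$ be integers, let $\gamma>0$, and let $C_1\subseteq[K]^n$ be a code (with at least two codewords) with $\mathrm{LCS}(C_1)=\gamma n$. Then there exist an integer $T=T(K,\gamma,k)$ satisfying $T\le O\big((2k/\gamma)^{2K+2}\big)$ and an injective map $\tau\colon[K]\to[k]^T$ such that the code $C_2\subseteq[k]^N$, $N=nT$, obtained by replacing each symbol of each codeword of $C_1$ by its image under $\tau$, has the following property: if $s$ is a common subsequence between two distinct codewords $c,\tilde c\in C_2$, then \[\operatorname{span} s\ \ge\ (k+\sqrt k)\,\operatorname{len} s-5\gamma kN.\] In particular, $\mathrm{LCS}(C_2)\le \frac{2+5\gamma k}{k+\sqrt k}N<\left(\frac{2}{k+\sqrt k}+5\gamma\right)N$.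
   Context: $[k]=\{1,\dots,k\}$. A word is a finite sequence of symbols; symbols are treated as distinguishable positions. A subsequence of a word $w$ is obtained by deleting symbols; a subword is a subsequence of consecutive symbols. The span $\operatorname{span}_w w'$ of a subsequence $w'$ of $w$ is the length of the shortest subword of $w$ containing $w'$. A common subsequence of words $w_1,w_2$ is a pair $s=(w_1',w_2')$ of subsequences $w_1'$ of $w_1$ and $w_2'$ of $w_2$ that are equal as words; $\operatorname{len} s$ is their common length and $\operatorname{span} s=\operatorname{span}_{w_1}w_1'+\operatorname{span}_{w_2}w_2'$. $\mathrm{LCS}(w_1,w_2)$ is the maximum length of a common subsequence, and for a code $C$ (a set of words of equal length), $\mathrm{LCS}(C)=\max_{c_1\ne c_2\in C}\mathrm{LCS}(c_1,c_2)$. *)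

(* Defs.v *)
From mathcomp Require Import all_boot all_order all_algebra.
From mathcomp Require Import reals.
Set Implicit Arguments. Unset Strict Implicit. Unset Printing Implicit Defensive.
Import Order.TTheory GRing.Theory Num.Theory.

Section Words.
Variable T : eqType.

(* A subsequence of a word w, with symbols treated as positions, is given by
   the strictly increasing list I of the (0-based) positions kept. *)
Definition is_pos_subseq (w : seq T) (I : seq nat) : bool :=
  sorted ltn I && all (fun i => i < size w) I.

Definition word_at (w : seq T) (I : seq nat) : seq (option T) :=
  map (onth w) I.

(* span: length of the shortest subword containing the positions I
   (0 for the empty subsequence). *)
Definition span_pos (I : seq nat) : nat :=
  if I is i :: _ then (last i I - i).+1 else 0.

(* A common subsequence s = (I1, I2) of w1, w2; len s = size I1,
   span s = span_pos I1 + span_pos I2. *)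
Definition common_subseq (w1 w2 : seq T) (I1 I2 : seq nat) : bool :=
  [&& is_pos_subseq w1 I1, is_pos_subseq w2 I2 & word_at w1 I1 == word_at w2 I2].

Definition lcs (w1 w2 : seq T) : nat :=
  \max_(m : (size w1).-tuple bool | subseq (mask m w1) w2) size (mask m w1).

End Words.

Definition lcs_code (K n : nat) (C : {set n.-tuple 'I_K}) : nat :=
  \max_(c1 in C) \max_(c2 in C | c2 != c1) lcs (tval c1) (tval c2).

Definition encode (K k T : nat) (tau : 'I_K -> T.-tuple 'I_k) (w : seq 'I_K)
  : seq 'I_k := flatten (map (fun a => tval (tau a)) w).

(* Main.v *)
Require Import Defs.
From mathcomp Require Import all_boot all_order all_algebra.
From mathcomp Require Import reals zify ring lra.
Set Implicit Arguments. Unset Strict Implicit. Unset Printing Implicit Defensive.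
Import Order.TTheory GRing.Theory Num.Theory.

(** The a-th symbol is sent to a periodic word with two scales A_a << B_a.  Up
    to rounding, on the j-th stretch of length B_a (of "flavour" i = j mod k) the
    word repeats the pattern 0^A 1^A ... (k-1)^A i^(sqrt k A) with A = A_a.
    Thus the flavour has density 1/sqrt k there, every other letter has density
    1/(k + sqrt k), and over a full period k B_a all letters are equidistributed.
    The scales are nested, A_b << A_a << B_a << B_b for a < b, with
    consecutive ratios r of order 1/gamma.

    Match the words X = tau a and Y = tau b with a < b.  On a run of X the letter
    is constant and Y is spread evenly, so x matches with the flavour of Y and y
    other matches use about sqrt k x + (k + sqrt k) y symbols of Y; on a stretch
    of Y the flavour is constant, so the x matches use about k x symbols of X.
    Together this is (k + sqrt k)(x + y).

    For two codewords of C_2, cut a common subsequence according to the blocks it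
    meets on both sides: blocks of different symbols obey the bound above, and
    equal symbols contribute at most T LCS(C_1) matches, because every T-th such
    match lies in a new block on both sides. *)

(** * Spans and densities of sets of positions *)

Lemma path_ltn_last (i : nat) (s : seq nat) : path ltn i s -> i <= last i s.
Proof.
elim: s i => //= j s IH i /andP[ij /IH]; exact: leq_trans (ltnW ij).
Qed.

Lemma span_pos_mem (i : nat) (I : seq nat) (t : nat) :
  sorted ltn (i :: I) -> t \in i :: I -> i <= t < i + span_pos (i :: I).
Proof.
move=> sI tI; have [I1 [I2 eI]] : exists I1 I2, i :: I = I1 ++ t :: I2.
  by case/splitPr: tI => I1 I2; exists I1, I2.
have lt : t <= last i I.
  have -> : last i I = last t I2 by rewrite -[LHS]/(last i (i :: I)) eI last_cat.
  apply: path_ltn_last; rewrite eI in sI.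
  exact: (subseq_sorted ltn_trans (suffix_subseq I1 (t :: I2)) sI).
have it : i <= t.
  move: tI; rewrite inE => /predU1P[-> //|tI]; apply: ltnW.
  by move/(order_path_min ltn_trans)/allP: sI; apply.
rewrite /=; lia.
Qed.

Lemma span_pos_subset (I J : seq nat) :
  sorted ltn I -> {subset J <= I} -> span_pos J <= span_pos I.
Proof.
case: J => [|j J] // sI sJ; case: I sI sJ => [|i I] sI sJ.
  by have := sJ j; rewrite mem_head => /(_ isT).
have /(span_pos_mem sI) := sJ j (mem_head _ _).
have /(span_pos_mem sI) := sJ (last j J) (mem_last _ _).
rewrite [span_pos (j :: J)]/=; lia.
Qed.

Lemma size_le_span_pos (I : seq nat) : sorted ltn I -> size I <= span_pos I.
Proof.
case: I => // i I sI.
rewrite -(size_iota i (span_pos (i :: I))); apply: uniq_leq_size.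
  exact: sorted_uniq ltn_trans ltnn _ sI.
by move=> t /(span_pos_mem sI); rewrite mem_iota.
Qed.

Lemma span_pos_le (I : seq nat) (N : nat) :
  all (fun t => t < N) I -> span_pos I <= N.
Proof.
case: I => // i I /allP aI; have := aI _ (mem_last i I); rewrite /=; lia.
Qed.

(** The two spanning intervals are disjoint. This superadditivity is what allows a span to be
    bounded piece by piece. *)
Lemma span_pos_cat (I J : seq nat) :
  sorted ltn (I ++ J) -> span_pos I + span_pos J <= span_pos (I ++ J).
Proof.
case: I => // i I; case: J => [|j J]; first by rewrite cats0 addn0.
rewrite /= cat_path /= last_cat /= => /and3P[/path_ltn_last iI Ij].
move/path_ltn_last; lia.
Qed.

Lemma span_pos_modn (T q : nat) (I : seq nat) :
  all (fun t => t %/ T == q) I -> span_pos [seq t %% T | t <- I] = span_pos I.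
Proof.
case: I => // i I /allP aI; rewrite /= (last_map (modn^~ T)).
have /eqP := aI _ (mem_last i I); have /eqP := aI _ (mem_head i I).
move=> qi ql; have := divn_eq i T; have := divn_eq (last i I) T.
rewrite qi ql; move: (q * T) (_ %% T) (i %% T) => c d e; lia.
Qed.

(* The map t |-> ((t - min I) / p, t mod p) is injective on I. *)
Lemma density_span (p l : nat) (g : pred nat) (I : seq nat) :
  0 < p -> sorted ltn I -> all (fun t => g (t %% p)) I ->
  count g (iota 0 p) <= l -> size I * p <= l * (span_pos I + p).
Proof.
case: I => // i I p0 sI /allP aI cl; set sp := span_pos _.
pose q := (sp + p).-1 %/ p.
suff le : size (i :: I) <= q * l.
  have qp : q * p <= sp + p.
    by apply: leq_trans (leq_pred _); exact: leq_trunc_div.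
  rewrite (leq_trans (leq_mul le (leqnn p))) // mulnAC mulnC.
  exact: leq_mul.
pose f t := ((t - i) %/ p, t %% p).
have fI : {in i :: I &, injective f}.
  move=> t u /(span_pos_mem sI)/andP[it _] /(span_pos_mem sI)/andP[iu _] [e1 e2].
  have : (t - i) %% p = (u - i) %% p.
    apply/eqP; rewrite -(eqn_modDr i) !subnK //; exact/eqP.
  move=> e3; have : t - i = u - i.
    by rewrite (divn_eq (t - i) p) (divn_eq (u - i) p) e1 e3.
  lia.
rewrite -(size_map f); set s := map _ _.
have : size s <= size [seq (a, b) | a <- iota 0 q, b <- filter g (iota 0 p)].
  apply: uniq_leq_size.
    by rewrite map_inj_in_uniq //; exact: sorted_uniq ltn_trans ltnn _ sI.
  move=> _ /mapP[t tI ->]; apply: allpairs_f.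
    rewrite mem_iota add0n /=; have /andP[it tl] := span_pos_mem sI tI.
    rewrite /q -/sp in tl *.
    have -> : (sp + p).-1 = sp.-1 + p by rewrite /sp /=; lia.
    rewrite divnDr // divnn p0 addn1 ltnS; apply: leq_div2r; lia.
  by rewrite mem_filter mem_iota /= add0n ltn_mod p0 andbT; apply: aI.
rewrite size_allpairs size_iota size_filter => /leq_trans; apply.
by rewrite leq_mul2l cl orbT.
Qed.

(** * Cutting a sequence along a monotone key *)

Lemma filter_ltnS (U : Type) (key : U -> nat) (s : seq U) (M : nat) :
  sorted (relpre key leq) s ->
  [seq p <- s | key p < M.+1] =
  [seq p <- s | key p < M] ++ [seq p <- s | key p == M].
Proof.
elim: s => //= x s IH xs; have {IH}IH := IH (path_sorted xs).
have [lt|gt|e] := ltngtP (key x) M.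
- by rewrite ltnS (ltnW lt) IH.
- by rewrite ltnS leqNgt gt /= IH.
rewrite e ltnSn IH; suff -> : [seq p <- s | key p < M] = [::] by [].
have xs' : all (fun p => M <= key p) s.
  rewrite -e; apply: (@order_path_min _ (relpre key leq)) xs.
  by move=> a b c; apply: leq_trans.
rewrite -(filter_pred0 s); elim: s xs' {IH xs} => //= y s IH /andP[My /IH ->].
by rewrite ltnNge My.
Qed.

(** The key is nondecreasing along [s], so its level sets are consecutive pieces of [s]. There are
    at most [M] nonempty ones, each level loses at most [e], and superadditivity of [G] adds the
    pieces up. *)
Lemma sum_pieces (F : realFieldType) (U : Type) (r : rel U) (key : U -> nat)
    (G : seq U -> F) (w : U -> F) (e : F) (s : seq U) (M : nat) :
  transitive r ->
  (forall s1 s2, sorted r (s1 ++ s2) -> (G s1 + G s2 <= G (s1 ++ s2))%R) ->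
  (0 <= G [::])%R ->
  (forall p q, r p q -> key p <= key q) ->
  sorted r s -> all (fun p => key p < M) s ->
  (forall c, (\sum_(p <- [seq p <- s | key p == c]) w p - e <=
              G [seq p <- s | key p == c])%R) ->
  (\sum_(p <- s) w p - M%:R * e <= G s)%R.
Proof.
move=> tr Gcat G0 rkey rs aM pieces.
suff : (\sum_(p <- [seq p <- s | (key p < M)%N]) w p - M%:R * e <=
        G [seq p <- s | (key p < M)%N])%R by rewrite (all_filterP aM).
elim: M {aM} => [|M IH].
  rewrite mul0r subr0.
  have -> : [seq p <- s | (key p < 0)%N] = [::].
    by apply: etrans (filter_pred0 s); apply: eq_filter => p; rewrite ltn0.
  by rewrite big_nil.
have kS := filter_ltnS M (sub_sorted rkey rs).
apply: le_trans (_ : (G [seq p <- s | (key p < M)%N] + G [seq p <- s | key p == M] <= _)%R).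
  have := pieces M; rewrite kS big_cat /= -[M.+1]addn1 natrD mulrDl mul1r.
  by move=> pM; apply: le_trans (lerD IH pM); rewrite opprD addrACA.
by rewrite kS; apply: Gcat; rewrite -kS; exact: sorted_filter.
Qed.

(** * Periodic words with two scales *)

Lemma count_iotaM (h : pred nat) (p q : nat) :
  count h (iota 0 (p * q)) =
  \sum_(i < p) count (fun u => h (i * q + u)) (iota 0 q).
Proof.
elim: p => [|p IH]; first by rewrite big_ord0.
rewrite mulSn addnC iotaD count_cat IH big_ord_recr /= add0n.
by congr (_ + _); rewrite -[X in iota X](addn0 (p * q)) iotaDl count_map.
Qed.

Section Word.
Variables k A S n : nat.
Hypotheses (k0 : 0 < k) (A0 : 0 < A) (n0 : 0 < n).
Local Notation P := (k * A + S).

(** A period carries [k.+1] runs: [k] of length [A], then a tail of length [S]. The minimum keeps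
    the whole tail in a single run even when it is longer than [A]. *)
Definition run (t : nat) : nat := t %/ P * k.+1 + minn k (t %% P %/ A).

(** The letter is read off the run index, so that its constancy on runs is immediate. In the tail,
    [r %/ k.+1] is the period, a further division by [n] gives the stretch, and its residue mod [k]
    is the flavour. *)
Definition run_letter (r : nat) : nat :=
  if r %% k.+1 < k then r %% k.+1 else r %/ k.+1 %/ n %% k.

Definition letter (t : nat) : nat := run_letter (run t).

Lemma period_gt0 : 0 < P.
Proof. by rewrite addn_gt0 muln_gt0 k0 A0. Qed.

Lemma letterE t : letter t =
  if t %% P %/ A < k then t %% P %/ A else t %/ (P * n) %% k.
Proof.
rewrite /letter /run_letter /run; set m := minn _ _.
have mk : m < k.+1 by rewrite ltnS geq_minl.
rewrite modnMDl (modn_small mk) divnMDl // (divn_small mk) addn0 divnMA /m.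
by case: (ltnP (t %% P %/ A) k) => h; rewrite ?h ?ltnn.
Qed.

Lemma letter_lt t : letter t < k.
Proof. by rewrite letterE; case: ifP => // _; rewrite ltn_mod. Qed.

Lemma run_homo t u : t <= u -> run t <= run u.
Proof.
move=> tu; rewrite /run; have := leq_div2r P tu.
rewrite leq_eqVlt => /predU1P[e|lt].
  rewrite e leq_add2l.
  have le : t %% P <= u %% P.
    by rewrite -(leq_add2l (u %/ P * P)) -{1}e -!divn_eq.
  have := leq_div2r A le; rewrite leq_min geq_minl /= => h.
  exact: leq_trans (geq_minr _ _) h.
apply: leq_trans (leq_addr _ _).
apply: (@leq_trans ((t %/ P).+1 * k.+1)); last by rewrite leq_mul2r lt.
by rewrite mulSn addnC leq_add2r (leq_trans (geq_minl _ _)).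
Qed.

Lemma run_lt t M : t < M * P -> run t < M * k.+1.
Proof.
rewrite -(ltn_divLR _ _ period_gt0) /run => lt.
apply: (@leq_trans ((t %/ P).+1 * k.+1)); last by rewrite leq_mul2r lt.
by rewrite mulSn addnC ltn_add2r ltnS geq_minl.
Qed.

Lemma letter_mod t : letter (t %% (k * (P * n))) = letter t.
Proof.
rewrite !letterE modn_dvdm; last by rewrite dvdn_mull // dvdn_mulr.
by rewrite -modn_divl modn_mod.
Qed.

Lemma count_micro (f m : nat) : m < k ->
  count (fun u => (if u %/ A < k then u %/ A else f) == m) (iota 0 P) =
  A + (f == m) * S.
Proof.
move=> mk; rewrite iotaD count_cat add0n; congr (_ + _).
  rewrite count_iotaM (bigD1 (Ordinal mk)) //= big1 ?addn0 => [|i].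
    apply/eqP; rewrite -[X in _ == X](size_iota 0 A) -all_count.
    apply/allP => u; rewrite mem_iota add0n /= => uA.
    by rewrite divnMDl // divn_small // addn0 mk eqxx.
  move=> im; apply/eqP; rewrite -leqn0 leqNgt -has_count.
  apply/hasPn => u; rewrite mem_iota add0n /= => uA.
  rewrite divnMDl // divn_small // addn0 ltn_ord.
  by apply: contra_neqN im => /eqP e; apply: val_inj.
have aI u : u \in iota (k * A) S -> u %/ A < k = false.
  by rewrite mem_iota => /andP[h _]; rewrite ltnNge leq_divRL // h.
apply/eqP; have [->|ne] := eqVneq f m.
  rewrite mul1n -[X in _ == X](size_iota (k * A)) -all_count.
  by apply/allP => u /aI ->; rewrite eqxx.
rewrite -leqn0 leqNgt -has_count.
by apply/hasPn => u /aI ->.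
Qed.

(** In each of the [n] periods of a stretch a letter occurs [A] times, and [S] more times when it is
    the flavour. Every letter is the flavour of exactly one of the [k] stretches, which gives n(kA +
    S) in total. *)
Lemma count_letter (m : nat) : m < k ->
  count (fun t => letter t == m) (iota 0 (k * (P * n))) = P * n.
Proof.
move=> mk; rewrite count_iotaM.
transitivity (\sum_(f < k) n * (A + (f == m :> nat) * S)).
  apply: eq_bigr => f _; rewrite [P * n]mulnC count_iotaM -[n in RHS]card_ord.
  rewrite -sum_nat_const; apply: eq_bigr => j _; rewrite -count_micro //.
  apply: eq_in_count => u; rewrite mem_iota add0n /= => uP.
  rewrite letterE; have -> : (f * (n * P) + (j * P + u)) %% P = u.
    by rewrite mulnA addnA -mulnDl modnMDl modn_small.
  have lt : j * P + u < n * P.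
    apply: (@leq_trans (j.+1 * P)); last by rewrite leq_mul2r ltn_ord orbT.
    by rewrite mulSn addnC ltn_add2r.
  rewrite [P * n]mulnC divnMDl ?muln_gt0 ?n0 ?period_gt0 // (divn_small lt).
  by rewrite addn0 (modn_small (ltn_ord f)).
rewrite -big_distrr /= mulnC; congr (_ * _); rewrite big_split /=.
rewrite sum_nat_const card_ord; congr (_ + _).
rewrite (bigD1 (Ordinal mk)) //= eqxx mul1n big1 ?addn0 // => i im.
by rewrite (_ : (i == m :> nat) = false) //; apply: contra_neqF im => /eqP e; apply: val_inj.
Qed.

End Word.

(** * Matchings between two such words *)

Definition lt2 : rel (nat * nat) := fun p q => (p.1 < q.1) && (p.2 < q.2).

Lemma lt2_trans : transitive lt2.
Proof.
move=> q p r /andP[a b] /andP[c d].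
by rewrite /lt2 (ltn_trans a c) (ltn_trans b d).
Qed.

Lemma sorted_fst (s : seq (nat * nat)) : sorted lt2 s -> sorted ltn (map fst s).
Proof. by apply: homo_sorted => p q /andP[]. Qed.

Lemma sorted_snd (s : seq (nat * nat)) : sorted lt2 s -> sorted ltn (map snd s).
Proof. by apply: homo_sorted => p q /andP[]. Qed.

Lemma lt2_head (p q : nat * nat) (s : seq (nat * nat)) :
  sorted lt2 (p :: s) -> q \in p :: s -> q = p \/ lt2 p q.
Proof.
move=> /(order_path_min lt2_trans)/allP ps; rewrite inE => /predU1P[->|/ps]; tauto.
Qed.

Section Pair.
Variables (F : realFieldType) (k A1 S1 n1 A2 S2 n2 T M1 M2 : nat).
Variables (alpha beta delta : F).
Hypotheses (k0 : 0 < k) (A1_0 : 0 < A1) (A2_0 : 0 < A2).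
Hypotheses (n1_0 : 0 < n1) (n2_0 : 0 < n2).
Local Notation P1 := (k * A1 + S1).
Local Notation P2 := (k * A2 + S2).
Local Notation X := (letter k A1 S1 n1).
Local Notation Y := (letter k A2 S2 n2).
Hypotheses (TM1 : T = M1 * (P2 * n2)) (TM2 : T = M2 * P1).
Local Open Scope ring_scope.
Hypotheses (alphaP : alpha * (A2 + S2)%:R <= P2%:R) (betaP : beta * A2%:R <= P2%:R).
Hypotheses (delta0 : 0 <= delta) (beta_le : beta <= k%:R + alpha + delta).

(* A stretch index: the flavour letter of the stretch is its residue mod k. *)
Let flavour (p : nat * nat) : nat := p.2 %/ (P2 * n2).
Let hit (p : nat * nat) : bool := Y p.2 == (flavour p %% k)%N.

Definition matching_in (s : seq (nat * nat)) : bool :=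
  sorted lt2 s && all (fun p => [&& (p.1 < T)%N, (p.2 < T)%N & X p.1 == Y p.2]) s.

Let P2_gt0 : (0 < P2)%N := period_gt0 S2 k0 A2_0.
Let P1_gt0 : (0 < P1)%N := period_gt0 S1 k0 A1_0.

Lemma flavour_lt (s : seq (nat * nat)) : matching_in s ->
  all (fun p => flavour p < M1)%N s.
Proof.
move=> /andP[_]; apply: sub_all => p /and3P[_ h _].
by rewrite /flavour ltn_divLR ?muln_gt0 ?P2_gt0 // -TM1.
Qed.

(** The weights [alpha] and [beta] are at most the inverse densities in [Y] of the flavour and of
    any other letter. Cutting at the runs of [X] and the stretches of [Y] fixes both the matched
    letter and the flavour, so each piece has a single weight and [density_span] applies with period
    [P2]; its end effect is the loss of [P2] per piece. *)
Lemma span_snd (s : seq (nat * nat)) : matching_in s ->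
  \sum_(p <- s) (if hit p then alpha else beta) - (M2 * k.+1 + M1)%:R * P2%:R
    <= (span_pos (map snd s))%:R.
Proof.
move=> ms; have /andP[ss /allP as_] := ms.
pose key p := (run k A1 S1 p.1 + flavour p)%N.
apply: (@sum_pieces F _ lt2 key (fun s => (span_pos (map snd s))%:R)) => //.
- exact: lt2_trans.
- move=> s1 s2 /sorted_snd; rewrite map_cat => /span_pos_cat.
  by rewrite -natrD ler_nat.
- move=> p q /andP[/ltnW h1 /ltnW h2].
  by apply: leq_add; [exact: run_homo | exact: leq_div2r].
- apply/allP => p ps; have /and3P[p1 _ _] := as_ p ps.
  have /(run_lt k0 A1_0) h1 : (p.1 < M2 * P1)%N by rewrite -TM2.
  have /allP/(_ p ps) h2 := flavour_lt ms.
  by rewrite /key -addSn; exact: leq_add h1 (ltnW h2).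
move=> c; set s' := filter _ s.
have ss' : sorted lt2 s' by apply: sorted_filter => //; exact: lt2_trans.
have s's p : p \in s' -> key p = c /\ p \in s.
  by rewrite mem_filter => /andP[/eqP].
case: s' ss' s's => [|p0 s1] ss' s's.
  by rewrite big_nil sub0r oppr_le0.
set s' := p0 :: s1 in ss' s's *.
(* Both summands of [key] are nondecreasing along the matching, so a constant sum fixes each of
   them. *)
have const p : p \in s' -> run k A1 S1 p.1 = run k A1 S1 p0.1 /\ flavour p = flavour p0.
  move=> ps; have [->//|/andP[/ltnW h1 /ltnW h2]] := lt2_head ss' ps.
  have [e _] := s's p ps; have [e0 _] := s's p0 (mem_head _ _).
  have := run_homo k A1 S1 h1; have : (flavour p0 <= flavour p)%N by exact: leq_div2r.
  move: e; rewrite -e0 /key.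
  move: (run _ _ _ p.1) (run _ _ _ p0.1) (flavour p) (flavour p0); lia.
pose m := X p0.1; pose f := (flavour p0 %% k)%N.
have Ym p : p \in s' -> Y p.2 = m.
  move=> ps; have [_ /as_ /and3P[_ _ /eqP <-]] := s's p ps.
  by rewrite /m /letter; have [-> _] := const p ps.
have hit_const p : p \in s' -> hit p = (f == m).
  by move=> ps; rewrite /hit Ym //; have [_ ->] := const p ps; rewrite eq_sym.
pose l := (A2 + (f == m) * S2)%N; pose w0 := if f == m then alpha else beta.
have -> : \sum_(p <- s') (if hit p then alpha else beta) = w0 * (size s')%:R.
  rewrite (eq_big_seq (fun=> w0)) => [|p ps]; last by rewrite hit_const.
  by rewrite big_const_seq count_predT iter_addr_0 mulr_natr.
have mk : (m < k)%N by exact: letter_lt.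
have := density_span P2_gt0 (sorted_snd ss') _ (eq_leq (count_micro S2 A2_0 f mk)).
have -> : all (fun t => (if t %% P2 %/ A2 < k then t %% P2 %/ A2 else f) == m)%N
              (map snd s').
  rewrite all_map; apply/allP => p ps /=; have := Ym p ps.
  by rewrite letterE //; have [_ e] := const p ps; rewrite -/(flavour p) e => ->.
move=> /(_ isT); rewrite size_map -/l => dens.
have w0l : w0 * l%:R <= P2%:R.
  by rewrite /w0 /l; case: (f == m); rewrite ?mul1n ?mul0n ?addn0.
have l0 : 0 < l%:R :> F by rewrite ltr0n /l addn_gt0 A2_0.
rewrite lerBlDr -natrD -(ler_pM2l l0) -natrM.
apply: le_trans (_ : (size s' * P2)%:R <= _); last by rewrite ler_nat.
by rewrite mulrA [l%:R * _]mulrC mulnC natrM ler_wpM2r.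
Qed.

(** Only the hits are kept, which cannot enlarge the span. Within one stretch of [Y] they all carry
    the same letter, whose density is exactly 1/k over a full period of [X]; each of the [M1]
    stretches loses one such period. *)
Lemma span_fst (s : seq (nat * nat)) : matching_in s ->
  k%:R * (count hit s)%:R - M1%:R * (k * (P1 * n1))%:R
    <= (span_pos (map fst s))%:R :> F.
Proof.
move=> ms; have /andP[ss /allP as_] := ms.
apply: le_trans (_ : (span_pos (map fst (filter hit s)))%:R <= _); last first.
  rewrite ler_nat; apply: span_pos_subset; first exact: sorted_fst.
  by move=> _ /mapP[p + ->]; rewrite mem_filter => /andP[_ ps]; exact: map_f.
have -> : k%:R * (count hit s)%:R = \sum_(p <- filter hit s) k%:R :> F.
  by rewrite big_const_seq count_predT iter_addr_0 mulr_natr size_filter.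
apply: (@sum_pieces F _ lt2 flavour (fun s => (span_pos (map fst s))%:R)) => //.
- exact: lt2_trans.
- move=> s1 s2 /sorted_fst; rewrite map_cat => /span_pos_cat.
  by rewrite -natrD ler_nat.
- by move=> p q /andP[_ /ltnW h]; exact: leq_div2r.
- by apply: sorted_filter => //; exact: lt2_trans.
- by rewrite all_filter; apply: sub_all (flavour_lt ms) => p /= ->; rewrite implybT.
move=> c; set s' := filter _ (filter _ s).
have ss' : sorted lt2 s' by do 2![apply: sorted_filter; first exact: lt2_trans].
have s's p : p \in s' -> X p.1 = (c %% k)%N.
  rewrite !mem_filter => /and3P[/eqP <- /eqP h /as_ /and3P[_ _ /eqP ->]].
  exact: h.
have ck : (c %% k < k)%N by rewrite ltn_mod.
have B0 : (0 < P1 * n1)%N by rewrite muln_gt0 P1_gt0.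
have kB0 : (0 < k * (P1 * n1))%N by rewrite muln_gt0 k0.
have := density_span kB0 (sorted_fst ss') _ (eq_leq (count_letter S1 k0 A1_0 n1_0 ck)).
have -> : all (fun t => X (t %% (k * (P1 * n1)))%N == (c %% k)%N) (map fst s').
  by rewrite all_map; apply/allP => p ps /=; rewrite letter_mod // s's.
move=> /(_ isT); rewrite size_map mulnA mulnC leq_pmul2l // => dens.
rewrite big_const_seq count_predT iter_addr_0 -mulrnA mulnC.
by rewrite lerBlDr -natrD ler_nat.
Qed.

(** With x hits and y other matches, the two previous bounds add up to (k + alpha) x + beta y, which
    is at least beta (x + y) - delta x. The last term is controlled by x <= T. *)
Lemma span_pair (s : seq (nat * nat)) : matching_in s ->
  beta * (size s)%:R -
   (delta * T%:R + M1%:R * (k * (P1 * n1))%:R + (M2 * k.+1 + M1)%:R * P2%:R)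
  <= (span_pos (map fst s) + span_pos (map snd s))%:R.
Proof.
move=> ms; have := span_fst ms; have := span_snd ms.
have -> : \sum_(p <- s) (if hit p then alpha else beta) =
    alpha * (count hit s)%:R + beta * (size s)%:R - beta * (count hit s)%:R.
  elim: s {ms} => [|p s IH]; first by rewrite big_nil !mulr0 addr0 subr0.
  rewrite big_cons IH /= -add1n !natrD !mulrDr.
  by case: (hit p); rewrite /=; lra.
have : delta * (count hit s)%:R <= delta * T%:R.
  apply: ler_wpM2l => //; rewrite ler_nat; apply: leq_trans (count_size _ _) _.
  have /andP[ss as_] := ms; rewrite -(size_map fst).
  apply: leq_trans (size_le_span_pos (sorted_fst ss)) (span_pos_le _).
  by rewrite all_map; apply: sub_all as_ => p /and3P[].
have : beta * (count hit s)%:R <= (k%:R + alpha + delta) * (count hit s)%:R.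
  exact: ler_wpM2r.
rewrite natrD !mulrDl; lra.
Qed.

End Pair.

(** * Common subsequences as matchings *)

Section Matchings.
Variable U : eqType.

Definition matching (w1 w2 : seq U) (s : seq (nat * nat)) : Prop :=
  sorted lt2 s /\ {in s, forall p,
    [/\ p.1 < size w1, p.2 < size w2 & onth w1 p.1 = onth w2 p.2]}.

Lemma sorted_zip (I J : seq nat) :
  sorted ltn I -> sorted ltn J -> sorted lt2 (zip I J).
Proof.
case: I J => [|i I] [|j J] //=.
elim: I i j J => [|i' I IH] i j [|j' J] //= /andP[h1 h2] /andP[h3 h4].
by rewrite /lt2 /= h1 h3; exact: IH.
Qed.

Lemma common_subseq_matching (w1 w2 : seq U) (I1 I2 : seq nat) :
  common_subseq w1 w2 I1 I2 ->
  [/\ matching w1 w2 (zip I1 I2), map fst (zip I1 I2) = I1 &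
      map snd (zip I1 I2) = I2].
Proof.
move=> /and3P[/andP[s1 a1] /andP[s2 a2] /eqP e].
have sz : size I1 = size I2 by have := congr1 size e; rewrite !size_map.
split; [split|exact/unzip1_zip/eq_leq|exact/unzip2_zip/eq_leq/esym].
  exact: sorted_zip.
move=> p pI; have p1 : p.1 \in I1.
  by rewrite -(unzip1_zip (eq_leq sz)) map_f.
have p2 : p.2 \in I2 by rewrite -(unzip2_zip (eq_leq (esym sz))) map_f.
split; [exact: (allP a1) | exact: (allP a2) |].
move: e pI; rewrite /word_at.
elim: I1 I2 sz {s1 s2 a1 a2 p1 p2} => [|i I IH] [|j J] //= [sz] [e1 e2].
by rewrite inE => /predU1P[-> //|]; apply: IH.
Qed.

Lemma subseq_nth_sorted (x0 : U) (w : seq U) (I : seq nat) :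
  sorted ltn I -> all (fun i => i < size w) I -> subseq (map (nth x0 w) I) w.
Proof.
move=> sI /allP aI; rewrite -{2}(mkseq_nth x0 w) /mkseq; apply: map_subseq.
have -> : I = [seq i <- iota 0 (size w) | i \in I]; last exact: filter_subseq.
apply: (irr_sorted_eq ltn_trans ltnn sI).
  by apply: sorted_filter; [exact: ltn_trans | exact: iota_ltn_sorted].
move=> i; rewrite mem_filter mem_iota /= add0n.
by case iI: (i \in I) => //=; rewrite aI.
Qed.

Lemma matching_le_lcs (w1 w2 : seq U) (s : seq (nat * nat)) :
  matching w1 w2 s -> size s <= lcs w1 w2.
Proof.
(* An empty [w1] admits no edge; otherwise its first symbol serves as default for [nth]. *)
case: w1 => [|x0 w1] [ss ms].
  by case: s ss ms => // p s _ /(_ p (mem_head _ _))[].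
set w := x0 :: w1 in ms *.
have e : map (nth x0 w) (map fst s) = map (nth x0 w2) (map snd s).
  rewrite -!map_comp; apply/eq_in_map => p /ms[_ _ /(congr1 (odflt x0))].
  by rewrite !odflt_onth.
have sub1 : subseq (map (nth x0 w) (map fst s)) w.
  apply: subseq_nth_sorted; first exact: sorted_fst.
  by rewrite all_map; apply/allP => p /ms[].
have sub2 : subseq (map (nth x0 w) (map fst s)) w2.
  rewrite e; apply: subseq_nth_sorted; first exact: sorted_snd.
  by rewrite all_map; apply/allP => p /ms[].
have /subseqP[m /eqP sm em] := sub1; rewrite em in sub2.
have := @leq_bigmax_cond _ (fun m : (size w).-tuple bool => subseq (mask m w) w2)
  (fun m => size (mask m w)) (Tuple sm) sub2.
by rewrite /= -em !size_map.
Qed.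

Lemma subseq_positions (u w : seq U) : subseq u w ->
  exists I, [/\ is_pos_subseq w I, size I = size u & word_at w I = map Some u].
Proof.
case/subseqP=> m sm ->; exists (mask m (iota 0 (size w))); split.
- apply/andP; split.
    apply: (subseq_sorted ltn_trans (mask_subseq _ _)); exact: iota_ltn_sorted.
  by apply/allP => i /mem_mask; rewrite mem_iota.
- by rewrite !size_mask // size_iota.
rewrite /word_at !map_mask; congr mask.
apply: (@eq_from_nth _ None); rewrite !size_map size_iota // => i iw.
by rewrite (nth_map 0) ?size_iota // nth_iota // add0n onthE.
Qed.

(** Serves to turn a bound valid for all common subsequences into one for [lcs]. *)
Lemma lcs_common_subseq (w1 w2 : seq U) :
  exists I1 I2, common_subseq w1 w2 I1 I2 /\ size I1 = lcs w1 w2.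
Proof.
rewrite /lcs.
apply: (big_ind (fun x => exists I1 I2, common_subseq w1 w2 I1 I2 /\ size I1 = x)).
- by exists [::], [::].
- by move=> x y hx hy; case: (leqP x y).
move=> m sub; have [I1 [h1 h2 h3]] := subseq_positions (mask_subseq m w1).
have [I2 [h4 h5 h6]] := subseq_positions sub.
by exists I1, I2; rewrite /common_subseq h1 h4 h3 h6 eqxx.
Qed.

End Matchings.

(** * Encoded words and their blocks *)

Lemma sorted_nth_gap (I : seq nat) (i d : nat) :
  sorted ltn I -> i + d < size I -> nth 0 I i + d <= nth 0 I (i + d).
Proof.
move=> sI; elim: d => [|d IH] h; first by rewrite !addn0.
rewrite addnS in h *; rewrite addnS; apply: leq_ltn_trans (IH (ltnW h)) _.
by apply: (sorted_ltn_nth ltn_trans) => //; rewrite inE // ltnW.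
Qed.

Section Blocks.
Variables (K k T : nat) (tau : 'I_K -> T.-tuple 'I_k).
Hypothesis T0 : 0 < T.

Lemma size_encode (w : seq 'I_K) : size (encode tau w) = size w * T.
Proof.
rewrite /encode; elim: w => //= a w IH; by rewrite size_cat size_tuple IH mulSn.
Qed.

Lemma onth_encode (a0 : 'I_K) (w : seq 'I_K) (t : nat) : t < size w * T ->
  onth (encode tau w) t = onth (tau (nth a0 w (t %/ T))) (t %% T).
Proof.
rewrite /encode; elim: w t => //= a w IH t ht.
rewrite onth_cat size_tuple; case: ltnP => h; first by rewrite divn_small // modn_small.
have e := subnK h; rewrite -{2 3}e.
rewrite divnDr ?dvdnn // divnn T0 addn1 /= modnDr IH //.
by rewrite mulSn in ht; lia.
Qed.

(* Every T-th edge of a matching moves to a new block on both sides. *)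
Lemma same_block_count (w1 w2 : seq 'I_K) (s : seq (nat * nat)) :
  sorted lt2 s ->
  {in s, forall p, [/\ p.1 < size w1 * T, p.2 < size w2 * T &
                       onth w1 (p.1 %/ T) = onth w2 (p.2 %/ T)]} ->
  size s <= T * lcs w1 w2.
Proof.
(* [q] is the size of [s] divided by [T], rounded up: the number of indices jT below the size of
   [s]. *)
move=> ss ms; pose q := (size s + T.-1) %/ T.
have le_q : size s <= q * T.
  have := ltn_ceil (size s + T.-1) T0; rewrite -/q mulSn; lia.
have jT j : j < q -> j * T < size s.
  move=> jq; have := leq_trunc_div (size s + T.-1) T; rewrite -/q => h.
  have : j.+1 * T <= q * T by rewrite leq_mul2r jq orbT.
  rewrite mulSn; lia.
pose g j := let p := nth (0, 0) s (j * T) in (p.1 %/ T, p.2 %/ T).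
have gap (I : seq nat) i j : sorted ltn I -> size I = size s -> j < q -> i < j ->
    nth 0 I (i * T) %/ T < nth 0 I (j * T) %/ T.
  move=> sI sz jq ij; have jT' := jT j jq; rewrite -sz in jT'.
  have ij' : i * T + T <= j * T by rewrite addnC -mulSn leq_mul2r ij orbT.
  have := @sorted_nth_gap I (i * T) (j * T - i * T) sI.
  rewrite subnKC ?(leq_trans (leq_addr _ _) ij') // => /(_ jT') h.
  have : nth 0 I (i * T) + T <= nth 0 I (j * T) by lia.
  move/(leq_div2r T); by rewrite divnDr ?dvdnn // divnn T0 addn1.
have sg : matching w1 w2 [seq g j | j <- iota 0 q].
  split.
    apply: (@homo_sorted_in _ _ (fun j => j < q) g ltn); last exact: iota_ltn_sorted.
      move=> i j _ jq ij; have jT' := jT j jq; have iT' := jT i (ltn_trans ij jq).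
      have := gap _ i j (sorted_fst ss) (size_map _ _) jq ij.
      have := gap _ i j (sorted_snd ss) (size_map _ _) jq ij.
      by rewrite /lt2 !(nth_map (0, 0)) // => -> ->.
    by apply/allP => j; rewrite mem_iota.
  move=> _ /mapP[j + ->]; rewrite mem_iota add0n /= => jq.
  have [] := ms _ (mem_nth (0, 0) (jT j jq)).
  by rewrite -!ltn_divLR.
have := matching_le_lcs sg; rewrite size_map size_iota => le.
by rewrite (leq_trans le_q) // mulnC leq_mul2l le orbT.
Qed.

Section BlockSpan.
Variables (F : realFieldType) (beta E : F).
Local Open Scope ring_scope.
Hypotheses (beta0 : 0 <= beta) (E0 : 0 <= E).
Hypothesis pair_span : forall (a b : 'I_K) (s : seq (nat * nat)), a != b ->
  matching (tau a) (tau b) s ->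
  beta * (size s)%:R - E <= (span_pos (map fst s) + span_pos (map snd s))%:R.

(** Along the matching, the sum of the two block indices takes at most 2n values and, both indices
    being monotone, each value fixes the pair of blocks. Pieces over different symbols are handled
    by [pair_span] at a loss of [E]; matches over equal symbols get weight 0, and by
    [same_block_count] there are at most [T * lcs w1 w2] of them. *)
Lemma span_encode (a0 : 'I_K) (n : nat) (w1 w2 : seq 'I_K) (I1 I2 : seq nat) :
  size w1 = n -> size w2 = n ->
  common_subseq (encode tau w1) (encode tau w2) I1 I2 ->
  beta * (size I1)%:R - (2 * n)%:R * E - beta * (T * lcs w1 w2)%:R <=
  (span_pos I1 + span_pos I2)%:R.
Proof.
move=> sw1 sw2 /common_subseq_matching[[ss ms] e1 e2].
move: ss ms e1 e2; set s := zip I1 I2 => ss ms e1 e2.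
rewrite -[X in _ <= (span_pos X + _)%:R]e1 -[X in _ <= (_ + span_pos X)%:R]e2.
have -> : size I1 = size s by rewrite -e1 size_map.
have {}ms p : p \in s -> [/\ (p.1 < n * T)%N, (p.2 < n * T)%N &
    onth (tau (nth a0 w1 (p.1 %/ T))) (p.1 %% T) =
    onth (tau (nth a0 w2 (p.2 %/ T))) (p.2 %% T)].
  move=> /ms[]; rewrite !size_encode sw1 sw2 => h1 h2.
  by rewrite !(onth_encode a0) ?sw1 ?sw2.
pose same (p : nat * nat) := nth a0 w1 (p.1 %/ T) == nth a0 w2 (p.2 %/ T).
have count_same : (count same s <= T * lcs w1 w2)%N.
  rewrite -size_filter; apply: same_block_count.
    by apply: sorted_filter => //; exact: lt2_trans.
  move=> p; rewrite mem_filter => /andP[/eqP h /ms[h1 h2 _]].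
  rewrite sw1 sw2 !onthE !(nth_map a0) ?sw1 ?sw2 ?ltn_divLR // h; by split.
suff pieces : \sum_(p <- s) (if same p then 0 else beta) - (2 * n)%:R * E <=
    (span_pos (map fst s) + span_pos (map snd s))%:R.
  apply: le_trans pieces; rewrite [leLHS]addrAC lerB //.
  apply: le_trans (_ : beta * (size s)%:R - beta * (count same s)%:R <= _).
    by rewrite lerB // ler_wpM2l // ler_nat.
  elim: (s) => [|p s' IH]; first by rewrite big_nil !mulr0 subr0.
  rewrite big_cons /= -add1n !natrD !mulrDr.
  by move: IH; case: (same p) => /=; lra.
pose key (p : nat * nat) := (p.1 %/ T + p.2 %/ T)%N.
apply: (@sum_pieces F _ lt2 key
          (fun s => (span_pos (map fst s) + span_pos (map snd s))%:R)) => //.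
- exact: lt2_trans.
- move=> s1 s2 ss12; rewrite -natrD ler_nat !map_cat addnACA.
  by apply: leq_add; apply: span_pos_cat; rewrite -map_cat;
    [exact: sorted_fst | exact: sorted_snd].
- by move=> p q /andP[/ltnW h1 /ltnW h2]; apply: leq_add; exact: leq_div2r.
- apply/allP => p /ms[h1 h2 _]; rewrite /key mul2n -addnn -addSn.
  by apply: leq_add; [|apply: ltnW]; rewrite ltn_divLR.
move=> c; set s' := filter _ s.
have ss' : sorted lt2 s' by apply: sorted_filter => //; exact: lt2_trans.
have s's p : p \in s' -> key p = c /\ p \in s.
  by rewrite mem_filter => /andP[/eqP].
case: s' ss' s's => [|p0 s1] ss' s's.
  by rewrite big_nil sub0r (le_trans (_ : _ <= 0)) // oppr_le0.
set s' := p0 :: s1 in ss' s's *.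
have const p : p \in s' -> (p.1 %/ T = p0.1 %/ T /\ p.2 %/ T = p0.2 %/ T)%N.
  move=> ps; have [->//|/andP[/ltnW h1 /ltnW h2]] := lt2_head ss' ps.
  have [e _] := s's p ps; have [e0 _] := s's p0 (mem_head _ _).
  have := leq_div2r T h1; have := leq_div2r T h2; move: e; rewrite -e0 /key.
  move: (p.1 %/ T)%N (p0.1 %/ T)%N (p.2 %/ T)%N (p0.2 %/ T)%N; lia.
have same_const p : p \in s' -> same p = same p0.
  by move=> ps; rewrite /same; have [-> ->] := const p ps.
rewrite (eq_big_seq (fun=> if same p0 then 0 else beta)) => [|p ps]; last first.
  by rewrite same_const.
rewrite big_const_seq count_predT iter_addr_0.
have [_|ne] := ifPn.
  by rewrite mul0rn sub0r (le_trans (_ : _ <= 0)) // oppr_le0.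
(* Within one pair of blocks, reduction mod [T] is a translation on either side, so it preserves
   order and spans. *)
pose md (p : nat * nat) := (p.1 %% T, p.2 %% T)%N.
have := @pair_span _ _ (map md s') ne.
rewrite size_map mulr_natr -!map_comp.
have -> : span_pos (map (fst \o md) s') = span_pos (map fst s').
  rewrite (map_comp (modn^~ T) fst) (@span_pos_modn T (p0.1 %/ T)%N) //.
  by rewrite all_map; apply/allP => p /const[/= -> _].
have -> : span_pos (map (snd \o md) s') = span_pos (map snd s').
  rewrite (map_comp (modn^~ T) snd) (@span_pos_modn T (p0.2 %/ T)%N) //.
  by rewrite all_map; apply/allP => p /const[_ /= ->].
apply; split.
  apply: (@homo_sorted_in _ _ (mem s') md lt2 lt2) => //; last exact/allP.
  move=> p q ps qs /andP[h1 h2]; have [p1 p2] := const p ps.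
  have [q1 q2] := const q qs; rewrite /lt2 /=.
  by move: h1 h2; rewrite {1}(divn_eq p.1 T) {1}(divn_eq q.1 T)
    {1}(divn_eq p.2 T) {1}(divn_eq q.2 T) p1 p2 q1 q2 !ltn_add2l => -> ->.
move=> _ /mapP[p ps ->]; have [_ /ms[_ _ h]] := s's p ps.
have [c1 c2] := const p ps; rewrite c1 c2 in h.
by rewrite !size_tuple !ltn_mod T0.
Qed.

End BlockSpan.
End Blocks.

Lemma matching_swap (U : eqType) (w1 w2 : seq U) (s : seq (nat * nat)) :
  matching w1 w2 s -> matching w2 w1 (map swap_pair s).
Proof.
move=> [ss ms]; split.
  by apply: homo_sorted ss => p q /andP[h1 h2]; rewrite /lt2 h1 h2.
by move=> _ /mapP[p /ms[h1 h2 h3] ->].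
Qed.

Lemma lcs_le_size (U : eqType) (w1 w2 : seq U) : lcs w1 w2 <= size w1.
Proof. by apply/bigmax_leqP => m _; exact: size_subseq (mask_subseq _ _). Qed.

(** * The map [tau] and its scales *)

Section Construction.
Variables k K r S : nat.
Hypotheses (k2 : 1 < k) (r2 : 1 < r).
Local Notation P := (k * r + S).

Definition block_length : nat := P * r ^ (2 * K).

(** The period is P r^(K-a) and the stretch P r^(K+a): each increment of [a] shortens the one and
    lengthens the other by the factor [r], which nests the scales. For a < K both divide
    [block_length]. *)
Definition scaled_letter (a : nat) : nat -> nat :=
  letter k (r * r ^ (K - a)) (S * r ^ (K - a)) (r ^ (2 * a)).

Let k0 : 0 < k := ltnW k2.
Let r0 : 0 < r := ltnW r2.
Let A_gt0 a : 0 < r * r ^ (K - a).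
Proof. by rewrite muln_gt0 expn_gt0 r0. Qed.
Let n_gt0 a : 0 < r ^ (2 * a).
Proof. by rewrite expn_gt0 r0. Qed.

Let periodE a : k * (r * r ^ (K - a)) + S * r ^ (K - a) = P * r ^ (K - a).
Proof. by rewrite mulnA -mulnDl. Qed.

Let flavourE a : a < K -> P * r ^ (K - a) * r ^ (2 * a) = P * r ^ (K + a).
Proof. by move=> aK; rewrite -mulnA -expnD; congr (_ * _ ^ _); lia. Qed.

(** For K > 0 this is the block length divided by [r], the unit in which all rounding and boundary
    losses are measured. *)
Definition base_error : nat := P * r ^ (2 * K).-1.

Lemma block_lengthE : 0 < K -> block_length = r * base_error.
Proof.
by move=> K0; rewrite /block_length /base_error mulnCA -expnS prednK // muln_gt0 K0.
Qed.

Lemma scaled_letter_lt (a t : nat) : scaled_letter a t < k.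
Proof. exact: letter_lt. Qed.

Definition tau (a : 'I_K) : block_length.-tuple 'I_k :=
  [tuple Ordinal (scaled_letter_lt a t) | t < block_length].

Lemma onth_tau (a : 'I_K) (t : nat) : t < block_length ->
  onth (tau a) t = Some (Ordinal (scaled_letter_lt a t)).
Proof. by move=> tT; apply: (tnth_onth _ _ (Ordinal tT)).1; rewrite tnth_mktuple. Qed.

(** For a < b, the position r r^(K-b) is where the second run of [tau b] starts, with letter 1,
    while [tau a] is still in its longer first run, with letter 0. *)
Lemma tau_inj : injective tau.
Proof.
suff ne (a b : 'I_K) : a < b -> tau a <> tau b.
  by move=> a b e; apply/val_inj; case: (ltngtP a b) => // /ne; rewrite e.
move=> ab /(congr1 (fun w : block_length.-tuple 'I_k => onth w (r * r ^ (K - b)))).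
have rb0 : 0 < r ^ (K - b) by rewrite expn_gt0 r0.
have le2 x : 2 * (r * r ^ x) <= P * r ^ x.
  by rewrite mulnA leq_mul2r (leq_trans _ (leq_addr _ _)) ?orbT // leq_mul2r k2 orbT.
have lt : r * r ^ (K - b) < r * r ^ (K - a).
  by rewrite ltn_mul2l r0 ltn_exp2l //; have := ltn_ord b; lia.
have ltP x : 0 < r ^ x -> r * r ^ x < P * r ^ x.
  by move=> x0; apply: leq_trans (le2 x); rewrite mul2n -addnn -addn1 leq_add2l muln_gt0 r0.
have ltT : r * r ^ (K - b) < block_length.
  apply: leq_trans (ltP _ rb0) _; rewrite leq_mul2l leq_pexp2l ?orbT //; lia.
rewrite !onth_tau // => -[]; rewrite /scaled_letter !letterE // !periodE.
have ra0 : 0 < r ^ (K - a) by rewrite expn_gt0 r0.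
rewrite (modn_small (ltP _ rb0)) divnn A_gt0 k2.
by rewrite (modn_small (ltn_trans lt (ltP _ ra0))) (divn_small lt) k0.
Qed.

Variable F : rcfType.
Local Notation rootk := (Num.sqrt k%:R : F).
Hypotheses (S_ge : (rootk * r%:R <= S%:R)%R) (S_le : (S%:R <= rootk * r%:R + 1)%R).

(* Scaling a word changes neither of the two densities: these are the weights
   alpha = sqrt k - 1/r (the rounding of S costs 1/r) and beta = k + sqrt k. *)
Lemma scaled_span_pair (a b : nat) (s : seq (nat * nat)) : a < b < K ->
  sorted lt2 s ->
  all (fun p => [&& p.1 < block_length, p.2 < block_length &
                    scaled_letter a p.1 == scaled_letter b p.2]) s ->
  ((k%:R + rootk) * (size s)%:R - (2 * k + 3)%:R * base_error%:R <=
   (span_pos (map fst s) + span_pos (map snd s))%:R :> F)%R.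
Proof.
move=> /andP[ab bK] ss as_; have aK := ltn_trans ab bK.
have rb0 : 0 < r ^ (K - b) by rewrite expn_gt0 r0.
have rF0 : (0 < r%:R :> F)%R by rewrite ltr0n.
have sk1 : (1 <= rootk)%R by rewrite -[X in (X <= _)%R]sqrtr1 ler_wsqrtr // ler1n.
have skk : (rootk * rootk = k%:R)%R by rewrite -expr2 sqr_sqrtr.
apply: le_trans (@span_pair F k (r * r ^ (K - a)) (S * r ^ (K - a)) (r ^ (2 * a))
  (r * r ^ (K - b)) (S * r ^ (K - b)) (r ^ (2 * b)) block_length
  (r ^ (K - b)) (r ^ (K + a)) (rootk - r%:R^-1)%R (k%:R + rootk)%R (r%:R^-1)%R
  k0 (A_gt0 a) (A_gt0 b) (n_gt0 a) (n_gt0 b) _ _ _ _ _ _ s _).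
(* The losses are at most 1, k, k + 1 and 1 times [base_error], coming from the rounding, the full
   periods of the first word, its runs, and the stretches of the second word. As a < b, no exponent
   of [r] exceeds 2K - 1. The sum is 2k + 3. *)
- rewrite lerD2l lerN2 !periodE !flavourE // -!natrM.
  have -> : (r%:R^-1 * block_length%:R = base_error%:R :> F)%R.
    by rewrite block_lengthE ?(leq_ltn_trans _ bK) // natrM mulKf // gt_eqF.
  rewrite -!natrD ler_nat.
  have bnd x : x <= (2 * K).-1 -> r ^ x <= r ^ (2 * K).-1 by exact: leq_pexp2l.
  have e1 : r ^ (K - b) * (k * (P * r ^ (K + a))) <= k * base_error.
    rewrite mulnCA leq_mul2l mulnCA leq_mul2l -expnD bnd ?orbT //; lia.
  have e2 : r ^ (K + a) * k.+1 * (P * r ^ (K - b)) <= k.+1 * base_error.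
    rewrite [r ^ _ * _]mulnC -mulnA leq_mul2l mulnCA leq_mul2l -expnD bnd ?orbT //; lia.
  have e3 : r ^ (K - b) * (P * r ^ (K - b)) <= base_error.
    rewrite mulnCA leq_mul2l -expnD bnd ?orbT //; lia.
  rewrite [X in _ + X <= _]mulnDl.
  apply: leq_trans (leq_add (leq_add (leqnn _) e1) (leq_add e2 e3)) _.
  rewrite !mulSn mulnDl; move: (k * base_error) base_error => x y; lia.
- by rewrite periodE flavourE // mulnCA -expnD /block_length; congr (_ * _ ^ _); lia.
- by rewrite periodE mulnCA -expnD /block_length; congr (_ * _ ^ _); lia.
(* Write S = sqrt k r + e with 0 <= e <= 1. Replacing sqrt k by sqrt k - 1/r gains (r + S)/r >= 1 +
   sqrt k, which outweighs the excess (sqrt k - 1) e. *)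
- rewrite periodE -mulnDl !natrM mulrA ler_wpM2r // !natrD natrM.
  have h : (r%:R^-1 * (r%:R + S%:R) >= 1 + rootk)%R.
    by rewrite mulrDr mulVf ?gt_eqF // lerD2l mulrC ler_pdivlMr.
  have : ((rootk - 1) * (S%:R - rootk * r%:R) <= (rootk - 1) * 1)%R.
    by rewrite ler_wpM2l ?subr_ge0 // lerBlDl.
  move: h; rewrite mulrBl; set q := Num.sqrt _ in skk *.
  by rewrite -skk; move: (r%:R^-1)%R => d; nra.
- rewrite periodE natrM [X in (_ <= X)%R]natrM mulrA ler_wpM2r // mulrDl natrD natrM.
  by rewrite lerD2l.
- by rewrite invr_ge0.
- lra.
by rewrite /matching_in ss.
Qed.

Lemma tau_span_pair (a b : 'I_K) (s : seq (nat * nat)) : a != b ->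
  matching (tau a) (tau b) s ->
  ((k%:R + rootk) * (size s)%:R - (2 * k + 3)%:R * base_error%:R <=
   (span_pos (map fst s) + span_pos (map snd s))%:R :> F)%R.
Proof.
wlog ab : a b s / a < b => [wl ne ms|_ [ss ms]].
  case: (ltngtP a b) => h; first exact: wl h ne ms.
    have := wl _ _ _ h _ (matching_swap ms); rewrite eq_sym ne => /(_ isT).
    by rewrite size_map -!map_comp [span_pos _ + _]addnC.
  by rewrite (val_inj h) eqxx in ne.
apply: scaled_span_pair (a) (b) _ _ ss _ => //; first by rewrite ab /=.
apply/allP => p /ms[]; rewrite !size_tuple => h1 h2.
by rewrite !onth_tau // h1 h2 => -[] /= ->.
Qed.

End Construction.

(** * Passing to codes and to the LCS *)

Lemma lcs_le_code (K n : nat) (C : {set n.-tuple 'I_K}) (c1 c2 : n.-tuple 'I_K) :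
  c1 \in C -> c2 \in C -> c2 != c1 -> lcs c1 c2 <= lcs_code C.
Proof.
move=> h1 h2 ne; apply: (bigop.bigmax_sup c1) => //; apply: (bigop.bigmax_sup c2) => //.
by rewrite h2.
Qed.

Lemma lcs_code_le (K n : nat) (C : {set n.-tuple 'I_K}) : lcs_code C <= n.
Proof.
apply/bigmax_leqP => c1 _; apply/bigmax_leqP => c2 _.
by rewrite -[X in _ <= X](size_tuple c1) lcs_le_size.
Qed.

Local Open Scope ring_scope.

(** Neither span exceeds [N], so a longest common subsequence has beta len <= (2 + gap) N. *)
Lemma span_bound_lcs (F : realFieldType) (U : eqType) (w1 w2 : seq U)
    (beta gap : F) (N : nat) : size w1 = N -> size w2 = N -> 0 < beta ->
  (forall I1 I2, common_subseq w1 w2 I1 I2 ->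
     beta * (size I1)%:R - gap * N%:R <= (span_pos I1 + span_pos I2)%:R) ->
  (lcs w1 w2)%:R <= (2 + gap) / beta * N%:R.
Proof.
move=> s1 s2 b0 H; have [I1 [I2 [com <-]]] := lcs_common_subseq w1 w2.
have /and3P[/andP[_ a1] /andP[_ a2] _] := com.
have := H _ _ com; rewrite mulrAC ler_pdivlMr //.
have : (span_pos I1 + span_pos I2)%:R <= (N + N)%:R :> F.
  by rewrite ler_nat leq_add // -?s1 -?s2 span_pos_le // s1 -s2.
rewrite natrD; lra.
Qed.

(** * Numerical choice of [r] and [S] *)

Section Estimates.
Variables (F : realType) (K k : nat) (gamma : F).
Hypotheses (K2 : (1 < K)%N) (k2 : (1 < k)%N) (g0 : 0 < gamma) (g1 : gamma <= 1).
Let r := (Num.truncn (3 / gamma)).+1.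
Let S := (Num.truncn (Num.sqrt k%:R * r%:R : F)).+1.

Let kF2 : 2 <= k%:R :> F. Proof. by rewrite ler_nat. Qed.

Lemma ratio_ge : 3 <= gamma * r%:R.
Proof. by rewrite mulrC -ler_pdivrMr // ltW // truncnS_gt. Qed.

(** Since gamma <= 1 and k >= 2, r <= 3/gamma + 1 <= 4/gamma <= 2k/gamma. *)
Lemma ratio_le : r%:R <= 2 * k%:R / gamma.
Proof.
have h : (Num.truncn (3 / gamma))%:R <= 3 / gamma by rewrite truncn_le divr_ge0 // ltW.
have h1 : 1 <= gamma^-1 by rewrite invf_ge1.
have h2 : 2 * gamma^-1 <= k%:R * gamma^-1 by rewrite ler_wpM2r // invr_ge0 ltW.
rewrite /r -addn1 natrD; lra.
Qed.

Lemma ratio_gt1 : (1 < r)%N.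
Proof.
have := ratio_ge; have := ler_wpM2r (ler0n F r) g1; rewrite mul1r => h1 h2.
have : 2 <= r%:R :> F by lra.
by rewrite ler_nat.
Qed.

Lemma excess_ge : Num.sqrt k%:R * r%:R <= S%:R :> F.
Proof. by rewrite ltW // truncnS_gt. Qed.

Lemma excess_le : S%:R <= Num.sqrt k%:R * r%:R + 1 :> F.
Proof. by rewrite /S -addn1 natrD lerD2r truncn_le mulr_ge0 // sqrtr_ge0. Qed.

Lemma sqrt_le_self : Num.sqrt k%:R <= k%:R :> F.
Proof.
rewrite -[X in _ <= X]ger0_norm // -sqrtr_sqr ler_wsqrtr // expr2.
by rewrite ler_peMr // ler1n ltnW.
Qed.

(** With q = 2k/gamma, the factor kr + S is at most 3kr <= 2qr, and r <= q. *)
Lemma block_length_le :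
  (block_length k K r S)%:R <= 2 * (2 * k%:R / gamma) ^+ (2 * K + 2).
Proof.
set q := 2 * k%:R / gamma.
have rq : r%:R <= q := ratio_le.
have kq : 2 * k%:R <= q.
  by rewrite /q ler_pdivlMr // ler_piMr // mulr_ge0.
have rF : 1 <= r%:R :> F by rewrite ler1n.
have P_le : (k * r + S)%:R <= 2 * q * r%:R.
  rewrite natrD natrM.
  have h1 := excess_le; have h2 := ler_wpM2r (ler0n F r) sqrt_le_self.
  have h3 := ler_wpM2r (ler0n F r) kq.
  have h4 : 1 <= k%:R * r%:R :> F by rewrite -natrM ler1n muln_gt0 (ltnW k2).
  lra.
have q0 : 0 <= q by rewrite (le_trans _ kq) ?mulr_ge0.
clearbody q; rewrite /block_length natrM natrX addn2 !exprS.
apply: le_trans (ler_pM _ _ P_le (_ : r%:R ^+ (2 * K) <= q ^+ (2 * K))) _ => //.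
- by rewrite exprn_ge0.
- by apply: lerXn2r => //; rewrite nnegrE.
by rewrite -!mulrA ler_wpM2l // ler_wpM2l // ler_wpM2r // exprn_ge0.
Qed.

(** As the block length is [r] times [base_error], the claim reduces to 4k + 6 <= 9k <= 3 gamma r k,
    where k >= 2 and gamma r >= 3. *)
Lemma error_le (n : nat) :
  (2 * n)%:R * ((2 * k + 3)%:R * (base_error k K r S)%:R) <=
  3 * gamma * k%:R * (n * block_length k K r S)%:R :> F.
Proof.
rewrite block_lengthE ?(ltnW K2) //; move: (base_error _ _ _ _) => e.
rewrite !natrM natrD natrM; set b : F := e%:R; set N : F := n%:R.
have Nb0 : 0 <= N * b by rewrite mulr_ge0.
have := ler_wpM2r (mulr_ge0 (ler0n F k) Nb0) ratio_ge.
have := ler_wpM2r Nb0 kF2.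
have -> : 3 * gamma * k%:R * (N * (r%:R * b)) = 3 * (gamma * r%:R * (k%:R * (N * b))) by ring.
have -> : 2 * N * ((2 * k%:R + 3) * b) = 4 * (k%:R * (N * b)) + 6 * (N * b) by ring.
by lra.
Qed.

End Estimates.

Theorem theorem3p1 (R : realType) :
  exists cst : R, 0 < cst /\
  forall (K k : nat) (gamma : R), (2 <= K)%N -> (2 <= k)%N -> 0 < gamma ->
  exists T : nat,
    T%:R <= cst * (2 * k%:R / gamma) ^+ (2 * K + 2) /\
    forall (n : nat) (C1 : {set n.-tuple 'I_K}),
      (1 <= n)%N -> (2 <= #|C1|)%N ->
      (lcs_code C1)%:R = gamma * n%:R ->
      exists tau : 'I_K -> T.-tuple 'I_k,
        injective tau /\
        forall c1 c2 : n.-tuple 'I_K, c1 \in C1 -> c2 \in C1 ->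
          encode tau c1 != encode tau c2 ->
          (forall I1 I2 : seq nat,
             common_subseq (encode tau c1) (encode tau c2) I1 I2 ->
             (span_pos I1 + span_pos I2)%:R >=
               (k%:R + Num.sqrt k%:R) * (size I1)%:R
               - 5 * gamma * k%:R * (n * T)%:R) /\
          (lcs (encode tau c1) (encode tau c2))%:R <=
             (2 + 5 * gamma * k%:R) / (k%:R + Num.sqrt k%:R) * (n * T)%:R /\
          (2 + 5 * gamma * k%:R) / (k%:R + Num.sqrt k%:R) * (n * T)%:R <
             (2 / (k%:R + Num.sqrt k%:R) + 5 * gamma) * (n * T)%:R.
Proof.
exists 2; split=> // K k gamma K2 k2 g0.
have q0 : 0 <= 2 * k%:R / gamma by rewrite divr_ge0 ?mulr_ge0 // ltW.
(* If gamma > 1, no code qualifies, since its LCS is at most n and n >= 1; hence T = 0 will do. *)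
have [g1|g1] := ltP 1 gamma.
  exists 0%N; split; first by rewrite mulr_ge0 // exprn_ge0.
  move=> n C1 n1 _ e; have : (lcs_code C1)%:R <= n%:R :> R by rewrite ler_nat lcs_code_le.
  by rewrite e leNgt ltr_pMl ?ltr0n // g1.
set r := (Num.truncn (3 / gamma)).+1.
set S := (Num.truncn (Num.sqrt k%:R * r%:R : R)).+1.
have r2 : (1 < r)%N := ratio_gt1 g0 g1.
exists (block_length k K r S); split; first exact: block_length_le.
move=> n C1 n1 _ lcsC; exists (tau r S k2); split; first exact: tau_inj.
set T := block_length k K r S.
have T0 : (0 < T)%N.
  by rewrite /T /block_length muln_gt0 addn_gt0 !muln_gt0 expn_gt0 !(ltnW r2) (ltnW k2).
set beta := k%:R + Num.sqrt k%:R.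
have sk0 : 0 < Num.sqrt k%:R :> R by rewrite sqrtr_gt0 ltr0n ltnW.
have beta0 : 0 < beta by rewrite ltr_wpDl.
move=> c1 c2 c1C c2C ne; have {}ne : c2 != c1 by apply: contra_neq ne => ->.
have spans I1 I2 : common_subseq (encode (tau r S k2) c1) (encode (tau r S k2) c2) I1 I2 ->
    beta * (size I1)%:R - 5 * gamma * k%:R * (n * T)%:R <= (span_pos I1 + span_pos I2)%:R.
  move=> com; have E0 : 0 <= (2 * k + 3)%:R * (base_error k K r S)%:R :> R by rewrite mulr_ge0.
  have pairs := @tau_span_pair k K r S k2 r2 R (excess_ge k gamma) (excess_le k gamma).
  have := span_encode T0 (ltW beta0) E0 pairs (Ordinal (ltnW K2)) (size_tuple c1)
    (size_tuple c2) com.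
  apply: le_trans; rewrite -addrA lerD2l -opprD lerN2.
  (* The 5 splits as 3 + 2: 3 for the losses bounded by [error_le], and 2 for the matches over equal
     symbols, since [beta] is at most 2k and the LCS of [C1] is gamma n. *)
  have -> : 5 * gamma * k%:R * (n * T)%:R =
    3 * gamma * k%:R * (n * T)%:R + 2 * k%:R * (gamma * (n * T)%:R) :> R by ring.
  apply: lerD; first exact: error_le.
  have lc : (lcs c1 c2)%:R <= gamma * n%:R by rewrite -lcsC ler_nat lcs_le_code.
  have -> : gamma * (n * T)%:R = T%:R * (gamma * n%:R) by rewrite natrM; ring.
  rewrite natrM; apply: ler_pM => //; first exact: ltW.
  - by rewrite mulr_ge0.
  - by have := sqrt_le_self R k2; rewrite /beta; lra.
  - exact: ler_wpM2l.
split=> //; split.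
  by apply: span_bound_lcs => //; rewrite size_encode // size_tuple.
have NT0 : (0 < n * T)%N by rewrite muln_gt0 n1.
(* Strictness comes from k < k + sqrt k. *)
rewrite ltr_pM2r ?ltr0n // mulrDl ltrD2l ltr_pdivrMr //.
by rewrite ltr_pM2l ?mulr_gt0 // /beta ltrDl.
Qed.
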